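(* Let $R=K[x_1,\ldots,x_n]$ be a standard graded polynomial ring over a field $K$ with $\mathfrak m=(x_1,\ldots,x_n)$, and let $I$ be an equigenerated $\mathfrak{m}$-primary monomial ideal in $R$ with $\alpha(I) = d$. Then $\mathrm{v}(\overline{I}) = d - 1 \leq \mathrm{v}(I)$. Moreover, for every $k \ge 1$, $$\mathrm{v}(\overline{I^k}) = kd - 1 \le \mathrm{v}(I^k).$$
   Context: A monomial ideal is equigenerated if all its minimal monomial generators have the same degree. The initial degree is $\alpha(I)=\min\{\deg f : 0\ne f\in I \text{ homogeneous}\}$. For a proper homogeneous ideal $I\subseteq R$, the v-number of $I$ is $$\mathrm{v}(I)=\min\{d\ge 0 : \text{there exist } f\in R_d \text{ and } \mathfrak p\in\operatorname{Ass}(I) \text{ such that } (I:f)=\mathfrak p\},$$ where $R_d$ is the space of homogeneous polynomials of degree $d$, $(I:f)=\{g\in R: gf\in I\}$, and $\operatorname{Ass}(I)$ is the set of associated primes of $R/I$. The integral closure $\overline{I}$ of an ideal $I$ is the ideal of all $x\in R$ satisfying an equation $x^m+a_1x^{m-1}+\cdots+a_m=0$ with $m\ge 1$ and $a_i\in I^i$. *)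

(* Defs.v *)
From HB Require Import structures.
From mathcomp Require Import all_boot all_order all_algebra.
From mathcomp Require Import mpoly.

Set Implicit Arguments.
Unset Strict Implicit.
Unset Printing Implicit Defensive.

Import GRing.Theory.
Local Open Scope ring_scope.

(* Ideals are Prop-valued subsets of the ring, compared extensionally: the
   ideals of [ring_quotient] are boolean (decidable) and always proper, which
   suits neither integral closures nor the power I^0 = R. *)

Section CommutativeAlgebra.
Variable R : comNzRingType.
Implicit Types (I J P Q S : R -> Prop) (f g : R).

Definition same_set I J : Prop := forall f, I f <-> J f.

Definition is_ideal I : Prop :=
  [/\ I 0, (forall f g, I f -> I g -> I (f + g)) & (forall f g, I g -> I (f * g))].

Definition ideal_gen S : R -> Prop := fun f =>
  exists2 r : seq (R * R),
    (forall c, c \in r -> S c.2) & f = \sum_(c <- r) c.1 * c.2.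

Definition ideal_mul I J : R -> Prop :=
  ideal_gen (fun h => exists f g, [/\ I f, J g & h = f * g]).

Fixpoint ideal_pow I (k : nat) : R -> Prop :=
  if k is k'.+1 then ideal_mul I (ideal_pow I k') else fun=> True.

Definition colon I f : R -> Prop := fun g => I (g * f).

Definition radical I : R -> Prop := fun f => exists k : nat, I (f ^+ k).

Definition is_prime P : Prop :=
  [/\ is_ideal P, ~ P 1 & forall f g, P (f * g) -> P f \/ P g].

Definition is_primary Q : Prop :=
  [/\ is_ideal Q, ~ Q 1 & forall f g, Q (f * g) -> Q f \/ radical Q g].

Definition primary_to P Q : Prop := is_primary Q /\ same_set (radical Q) P.

(* The annihilator of the class of f in R/I is (I : f). *)
Definition is_associated_prime I P : Prop :=
  is_prime P /\ exists f, same_set (colon I f) P.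

Definition integral_closure I : R -> Prop := fun x =>
  exists m : nat, (0 < m)%N /\
  exists a : nat -> R,
    (forall i : nat, (1 <= i <= m)%N -> ideal_pow I i (a i)) /\
    x ^+ m + \sum_(1 <= i < m.+1) a i * x ^+ (m - i) = 0.

End CommutativeAlgebra.

Definition is_min (P : nat -> Prop) (m : nat) : Prop :=
  P m /\ forall m' : nat, P m' -> (m <= m')%N.

Section PolynomialIdeals.
Variables (n : nat) (K : fieldType).
Implicit Types (I : {mpoly K[n]} -> Prop) (S : 'X_{1..n} -> Prop).

Definition irrelevant_ideal : {mpoly K[n]} -> Prop :=
  ideal_gen (fun f => exists i : 'I_n, f = 'X_i).

Definition monomial_gen S : {mpoly K[n]} -> Prop :=
  ideal_gen (fun f => exists2 m, S m & f = 'X_[m]).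

Definition is_monomial_ideal I : Prop := exists S, same_set I (monomial_gen S).

Definition minimal_monomial_generators I S : Prop :=
  same_set I (monomial_gen S) /\
  forall S', (forall m, S' m -> S m) -> same_set I (monomial_gen S') ->
    forall m, S m -> S' m.

(* Every monomial ideal has exactly one minimal set of monomial generators. *)
Definition equigenerated I : Prop :=
  exists S, minimal_monomial_generators I S /\
    forall m m', S m -> S m' -> mdeg m = mdeg m'.

(* alpha(I) = d *)
Definition is_initial_degree I (d : nat) : Prop :=
  is_min (fun e => exists f : {mpoly K[n]}, [/\ f <> 0, I f & f \is e.-homog]) d.

(* v(I) = v.  A relation instead of a function, so that no value is assigned
   when the defining set of degrees is empty. *)
Definition is_vnumber I (v : nat) : Prop :=
  is_min (fun e => exists f P,
    [/\ f \is e.-homog, is_associated_prime I P & same_set (colon I f) P]) v.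

End PolynomialIdeals.

Arguments irrelevant_ideal n K : clear implicits.

(* Main.v *)
(* Equigeneration in degree d and m-primariness put every x_i^d in I, and
   I is contained in m^d; hence J = I^k satisfies
   (x_1^N, ..., x_n^N) <= J <= m^N with N = kd.  This squeezes the integral
   closure of J to m^N: lowest-degree forms give one inclusion, and for the
   other, if M = nN, then m^(N+M) = (x_1^N, ..., x_n^N) m^M by the pigeonhole
   principle, so the determinant trick applied to the monomials of degree M
   shows that every element of m^N is integral over J.  If (J : f) is prime, it
   contains every x_i, so x_i f lies in m^N and deg f >= N - 1; for m^N itself
   x_1^(N-1) attains this bound. *)

Require Import Defs.
From mathcomp Require Import all_boot all_order perm all_algebra.
From mathcomp Require Import mpoly zify ring.
From Stdlib Require Import Classical.

Set Implicit Arguments.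
Unset Strict Implicit.
Unset Printing Implicit Defensive.

Import GRing.Theory.
Local Open Scope ring_scope.

(** * Ideals, their powers, and the determinant trick *)

Section Ideals.
Variable R : comNzRingType.
Implicit Types (I J S : R -> Prop) (f g : R).

Lemma ideal_sum J : is_ideal J ->
  forall (T : Type) (r : seq T) (P : pred T) (F : T -> R),
  (forall i, P i -> J (F i)) -> J (\sum_(i <- r | P i) F i).
Proof. by case=> J0 JD _ T r P F JF; apply: big_ind. Qed.

Lemma ideal_mulr J f g : is_ideal J -> J f -> J (f * g).
Proof. by case=> _ _ JM Jf; rewrite mulrC; apply: JM. Qed.

Lemma ideal_opp J f : is_ideal J -> J f -> J (- f).
Proof. by case=> _ _ JM Jf; rewrite -mulN1r; apply: JM. Qed.

Lemma ideal_gen_ideal S : is_ideal (ideal_gen S).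
Proof.
split.
- by exists [::]; rewrite ?big_nil.
- move=> f g [r1 S1 ->] [r2 S2 ->]; exists (r1 ++ r2); last by rewrite big_cat.
  by move=> c; rewrite mem_cat => /orP[/S1|/S2].
- move=> f g [r Sr ->]; exists [seq (f * c.1, c.2) | c <- r].
    by move=> c /mapP[c' /Sr Sc' ->].
  by rewrite big_map mulr_sumr; apply: eq_bigr => c _; rewrite mulrA.
Qed.

Lemma ideal_gen_id S f : S f -> ideal_gen S f.
Proof.
move=> Sf; exists [:: (1, f)]; last by rewrite big_seq1 mul1r.
by move=> c; rewrite inE => /eqP ->.
Qed.

Lemma ideal_gen_sub S J :
  is_ideal J -> (forall f, S f -> J f) -> forall f, ideal_gen S f -> J f.
Proof.
move=> Jid SJ f [r Sr ->]; rewrite big_seq; apply: ideal_sum => // c /Sr Sc.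
by case: Jid => _ _; apply; apply: SJ.
Qed.

Lemma ideal_pow_ideal J k : is_ideal (ideal_pow J k).
Proof. by case: k => [|k] //; apply: ideal_gen_ideal. Qed.

Lemma ideal_powS J k f g :
  J f -> ideal_pow J k g -> ideal_pow J k.+1 (f * g).
Proof. by move=> Jf Jg; apply: ideal_gen_id; exists f, g. Qed.

Lemma ideal_pow1 J f : J f -> ideal_pow J 1 f.
Proof. by move=> Jf; rewrite -[f]mulr1; apply: ideal_powS. Qed.

Lemma ideal_pow_exp J k f : J f -> ideal_pow J k (f ^+ k).
Proof. by move=> Jf; elim: k => // k IHk; rewrite exprS; apply: ideal_powS. Qed.

Lemma ideal_pow_le J a b f : (a <= b)%N -> ideal_pow J b f -> ideal_pow J a f.
Proof.
elim: a b f => [|a IHa] [|b] f //= ab; apply: ideal_gen_sub.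
  exact: ideal_gen_ideal.
by move=> _ [g [h [Jg /(IHa b) Jh ->]]]; apply: ideal_powS => //; apply: Jh.
Qed.

Lemma ideal_powD J a b f g :
  ideal_pow J a f -> ideal_pow J b g -> ideal_pow J (a + b) (f * g).
Proof.
move=> Jf Jg; elim: a f Jf => [|a IHa] f Jf.
  by case: (ideal_pow_ideal J b) => _ _; apply.
rewrite addSn; have [X0 XD XM] := ideal_pow_ideal J (a + b).+1.
(* The [f] with [f * g] in the target power form an ideal, so only generators of [ideal_pow J a.+1]
   need checking. *)
apply: (ideal_gen_sub (J := fun f => ideal_pow J (a + b).+1 (f * g))) Jf.
  split=> [|f1 f2 J1 J2|f1 f2 J2].
  - by rewrite mul0r.
  - by rewrite mulrDl; apply: XD.
  - by rewrite -mulrA; apply: XM.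
by move=> _ [h1 [h2 [Jh1 Jh2 ->]]]; rewrite -mulrA; apply: ideal_powS; auto.
Qed.

(* The polynomials whose coefficients satisfy the degree condition on the
   coefficients of an equation of integral dependence of degree [s]. *)
Definition graded_coefs J s (p : {poly R}) : Prop :=
  forall i, ideal_pow J (s - i) p`_i.

Lemma graded_coefsM J s t p q :
  graded_coefs J s p -> graded_coefs J t q -> graded_coefs J (s + t) (p * q).
Proof.
move=> Jp Jq k; rewrite coefM; apply: ideal_sum => [|i _].
  exact: ideal_pow_ideal.
apply: (@ideal_pow_le _ _ ((s - i) + (t - (k - i)))%N); last exact: ideal_powD.
by have := ltn_ord i; lia.
Qed.

Lemma graded_coefs_prod J (T : Type) (r : seq T) (F : T -> {poly R}) :
  (forall i, graded_coefs J 1 (F i)) ->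
  graded_coefs J (size r) (\prod_(i <- r) F i).
Proof.
move=> JF; elim: r => [|i r IHr]; first by case.
by rewrite big_cons /= -add1n; apply: graded_coefsM.
Qed.

(** Each Leibniz term multiplies [s] entries of ['X - A], and each entry has its constant
    coefficient in [J]. *)
Lemma graded_coefs_char_poly J s (A : 'M[R]_s) :
  is_ideal J -> (forall i j, J (A i j)) -> graded_coefs J s (char_poly A).
Proof.
move=> Jid JA k; rewrite /char_poly /determinant coef_sum.
apply: ideal_sum => [|t _]; first exact: ideal_pow_ideal.
(* The sign of the permutation enters in grade 0, where the condition is vacuous. *)
apply: (@graded_coefsM J 0) k => // k; move: k.
suff : graded_coefs J (size (enum 'I_s))
    (\prod_(i <- enum 'I_s) char_poly_mx A i (t i)).
  by move=> JP k; move: (JP k); rewrite size_enum_ord big_enum.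
apply: graded_coefs_prod => i [|j] //.
rewrite !mxE coefB coefMn coefX mul0rn sub0r coefC eqxx subn0.
by apply: ideal_opp; [apply: ideal_pow_ideal|apply: ideal_pow1; apply: JA].
Qed.

End Ideals.

(** With [A] the matrix of the [a j], [f%:M - A] kills the vector [w], so its determinant kills each
    [w i]. In a domain one nonzero [w i] makes [f] a root of [char_poly A], whose coefficient of
    index [s - i] lies in [ideal_pow J i]. *)
Lemma determinant_trick (R : idomainType) (J : R -> Prop) f s (w : 'I_s -> R) :
  is_ideal J -> (exists i, w i != 0) ->
  (forall i, exists2 a : 'I_s -> R,
    forall j, J (a j) & f * w i = \sum_j a j * w j) ->
  integral_closure J f.
Proof.
move=> Jid [i0 wi0] /fin_all_exists2[a Ja fw].
pose A : 'M[R]_s := \matrix_(i, j) a i j.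
have pf0 : (char_poly A).[f] = 0.
  apply: (mulIf wi0); rewrite mul0r.
  pose B : 'M[R]_s := f%:M - A.
  have -> : (char_poly A).[f] = \det B.
    rewrite -[LHS]/(horner_eval f _) /char_poly -det_map_mx; congr (\det _).
    apply/matrixP=> i j; rewrite !mxE /= /horner_eval.
    by rewrite hornerD hornerN hornerC hornerMn hornerX.
  pose W : 'cV[R]_s := \col_i w i.
  have BW : B *m W = 0.
    apply/matrixP=> i j; rewrite mulmxBl mul_scalar_mx !mxE fw.
    by apply/eqP; rewrite subr_eq0; apply/eqP/eq_bigr => k _; rewrite !mxE.
  have : (\det B)%:M *m W = 0 by rewrite -mul_adj_mx -mulmxA BW mulmx0.
  by move/matrixP/(_ i0 ord0); rewrite mul_scalar_mx !mxE.
have s_gt0 : (0 < s)%N by apply: leq_ltn_trans (ltn_ord i0).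
exists s; split=> //; exists (fun i => (char_poly A)`_(s - i)); split.
  move=> i /andP[_ le_is]; rewrite -{1}(subKn le_is).
  by apply: graded_coefs_char_poly => // k j; rewrite mxE.
have lead : (char_poly A)`_s = 1.
  by have /monicP := char_poly_monic A; rewrite /lead_coef size_char_poly.
rewrite -[RHS]pf0 horner_coef size_char_poly big_ord_recr /= lead mul1r addrC.
congr (_ + _); rewrite big_add1 /= big_mkord (reindex_inj rev_ord_inj) /=.
apply: eq_bigr => i _; rewrite (_ : s - (s - i.+1).+1 = i)%N //.
by have := ltn_ord i; lia.
Qed.


(** Strong induction with excluded middle, since [P] is not assumed decidable. *)
Lemma is_min_exists (P : nat -> Prop) : (exists e, P e) -> exists e, is_min P e.
Proof.
case=> e; elim/ltn_ind: e => e IHe Pe.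
case: (classic (exists2 e', P e' & (e' < e)%N)) => [[e' /[swap]]|no_lt].
  exact: IHe.
exists e; split=> // e' Pe'; rewrite leqNgt; apply/negP => lt_e.
by apply: no_lt; exists e'.
Qed.

(** * Powers of the irrelevant ideal contain integral closures *)

Section IrrelevantPowers.
Variables (K : fieldType) (n : nat).
Implicit Types (f g : {mpoly K[n]}) (J P : {mpoly K[n]} -> Prop).
Implicit Types (m : 'X_{1..n}) (N k : nat).

(* [ordge N] is the [N]-th power of the irrelevant ideal. *)
Definition ordge N f : Prop := forall m, (mdeg m < N)%N -> f@_m = 0.

Lemma ordgeM a b f g : ordge a f -> ordge b g -> ordge (a + b) (f * g).
Proof.
move=> fa gb m lt_m; rewrite mcoeffM big1 // => k /eqP/(congr1 mdeg).
rewrite mdegD => mE.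
have [lt_a|le_a] := ltnP (mdeg k.1) a; first by rewrite fa // mul0r.
rewrite gb ?mulr0 // -(ltn_add2l (mdeg k.1)) -mE.
by apply: leq_trans lt_m _; rewrite leq_add2r.
Qed.

Lemma ordge_le a b f : (a <= b)%N -> ordge b f -> ordge a f.
Proof. by move=> ab fb m lt_m; apply: fb; apply: leq_trans ab. Qed.

Lemma ordge0 f : ordge 0 f. Proof. by []. Qed.

Lemma ordge_ideal N : is_ideal (ordge N).
Proof.
split=> [m _|f g fN gN m lt_m|f g gN]; first by rewrite mcoeff0.
  by rewrite mcoeffD fN // gN // addr0.
exact: (ordgeM (ordge0 f) gN).
Qed.

Lemma ordgeX N m : (N <= mdeg m)%N -> ordge N 'X_[m].
Proof.
by move=> le_m m' lt_m'; rewrite mcoeffX; case: eqP lt_m' => // <-; lia.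
Qed.

Lemma ordge_exp a k f : ordge a f -> ordge (k * a) (f ^+ k).
Proof. by move=> fa; elim: k => // k IHk; rewrite exprS mulSn; apply: ordgeM. Qed.

Lemma ordge_pow J N k f : (forall g, J g -> ordge N g) ->
  ideal_pow J k f -> ordge (k * N) f.
Proof.
move=> JN; elim: k f => // k IHk f; apply: ideal_gen_sub.
  exact: ordge_ideal.
by move=> _ [g [h [/JN gN /IHk hN ->]]]; rewrite mulSn; apply: ordgeM.
Qed.

Lemma ordge_sub J N f : is_ideal J ->
  (forall m, (N <= mdeg m)%N -> J 'X_[m]) -> ordge N f -> J f.
Proof.
move=> Jid JX fN; rewrite [f]mpolyE big_seq; apply: ideal_sum => // m.
rewrite mcoeff_msupp => fm; rewrite -mul_mpolyC.
case: Jid => _ _; apply; apply: JX; rewrite leqNgt; apply: contraNN fm => lt_m.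
by apply/eqP/fN.
Qed.

Lemma dhomog_ordge f e : f \is e.-homog -> ordge e f.
Proof. by move=> fe m lt_m; apply: (dhomog_nemf_coeff fe); rewrite ltn_eqF. Qed.

Lemma ordge_dhomog_eq0 f e N :
  f \is e.-homog -> ordge N f -> (e < N)%N -> f = 0.
Proof.
move=> fe fN lt_e; apply/mpolyP => m; rewrite mcoeff0.
have [me|me] := eqVneq (mdeg m) e; first by rewrite fN ?me.
exact: (dhomog_nemf_coeff fe).
Qed.

Lemma mcoeff_pihomog e f m :
  (pihomog mdeg e f)@_m = if mdeg m == e then f@_m else 0.
Proof.
transitivity (\sum_(m' <- msupp f)
  (if mdeg m == e then (f@_m' *: 'X_[m'])@_m else 0)); last first.
  by case: eqP => _; rewrite ?big1_eq // -raddf_sum -mpolyE.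
rewrite pihomogE raddf_sum big_mkcond; apply: eq_bigr => m' _ /=.
rewrite mcoeffZ mcoeffX; have [->|_] := eqVneq m' m => //.
by rewrite mulr0 !if_same.
Qed.

(** The components of [f] of degree [k < N] vanish in turn. In the integral equation all terms but
    [f ^+ s] have order above [s * k], hence so does [f ^+ s], and so does [y ^+ s] for the
    component [y] of degree [k]. Being a form of degree [s * k], [y ^+ s] is zero. *)
Lemma ordge_integral_closure J N f : (forall g, J g -> ordge N g) ->
  integral_closure J f -> ordge N f.
Proof.
move=> JN [s [s_gt0 [a [Ja f_int]]]].
suff fk k : (k <= N)%N -> ordge k f by exact: fk.
elim: k => // k IHk lt_kN; have {IHk} fk := IHk (ltnW lt_kN).
pose y := pihomog mdeg k f.
have yk : y \is k.-homog by apply: pihomogP.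
have fyk : ordge k.+1 (f - y).
  move=> m lt_m; rewrite mcoeffB mcoeff_pihomog; case: eqP => [_|/eqP ne_m].
    by rewrite subrr.
  by rewrite fk ?subr0 //; lia.
suff y0 : y = 0 by rewrite -[f]subr0 -y0.
have [_ ordD _] := ordge_ideal (s * k).+1.
have fsk : ordge (s * k).+1 (f ^+ s).
  move/eqP: f_int; rewrite addr_eq0 => /eqP ->.
  apply: (ideal_opp (ordge_ideal _)).
  rewrite big_seq; apply: (ideal_sum (ordge_ideal _)).
  move=> i; rewrite mem_index_iota => le_i.
  (* Here [1 <= i] and [k < N] give the extra unit of order. *)
  apply: (@ordge_le _ (i * N + (s - i) * k)); first by nia.
  by apply: ordgeM; [apply: (ordge_pow JN); apply: Ja; lia|apply: ordge_exp].
have ysk : ordge (s * k).+1 (y ^+ s).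
  rewrite -[y ^+ s](subKr (f ^+ s)); apply: ordD => //.
  apply: (ideal_opp (ordge_ideal _)).
  (* The factor [f - y] has order [k.+1]; each term of the cofactor is a product of [s.-1] factors
     of order [k]. *)
  rewrite subrXX; apply: (@ordge_le _ (k.+1 + s.-1 * k)); first by nia.
  apply: ordgeM => //; apply: (ideal_sum (ordge_ideal _)) => i _.
  apply: (@ordge_le _ ((s.-1 - i) * k + i * k)).
    by have := ltn_ord i; nia.
  by apply: ordgeM; apply: ordge_exp => //; apply: dhomog_ordge.
have /eqP : y ^+ s = 0.
  apply: (ordge_dhomog_eq0 _ ysk); [exact: (dhomogMn _ yk)|by rewrite mulnC].
by rewrite expf_eq0 => /andP[_ /eqP].
Qed.

(** * Divisibility of monomials and integrality over the ideal *)

Lemma mnm_divisor m k : (k <= mdeg m)%N -> exists2 m', (m' <= m)%MM & mdeg m' = k.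
Proof.
elim: k => [|k IHk] lt_k; first by exists 0%MM; rewrite ?mdeg0 // -[m]addm0 lem_addl.
have [m' m'm m'k] := IHk (ltnW lt_k).
have /existsP[i lt_i] : [exists i, (m' i < m i)%N].
  apply: contraLR lt_k; rewrite negb_exists => /forallP no_i.
  rewrite -leqNgt -m'k !mdegE; apply: leq_sum => i _.
  by rewrite leqNgt.
exists (m' + U_(i))%MM; last by rewrite mdegD mdeg1 m'k addn1.
apply/mnm_lepP => j; rewrite mnmDE mnm1E.
by case: eqP => [<-|_]; rewrite ?addn1 ?addn0 //; apply/mnm_lepP.
Qed.

Lemma mnm_pigeonhole m N : (n * N < mdeg m)%N -> exists i, (U_(i) *+ N <= m)%MM.
Proof.
move=> lt_m; have /existsP[i le_i] : [exists i, (N <= m i)%N].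
  apply: contraLR lt_m; rewrite negb_exists => /forallP no_i.
  rewrite -leqNgt mdegE -[X in (X * _)%N]card_ord -sum_nat_const.
  by apply: leq_sum => i _; rewrite ltnW // ltnNge.
exists i; apply/mnm_lepP => j; rewrite mulmnE mnm1E.
by case: eqP => [<-|_]; rewrite ?mul1n ?mul0n.
Qed.

Section PrimaryIdeal.
Variables (J : {mpoly K[n]} -> Prop) (N : nat).
Hypotheses (Jid : is_ideal J) (JX : forall i : 'I_n, J ('X_i ^+ N)).

Lemma primary_mnm m : (n * N < mdeg m)%N -> J 'X_[m].
Proof.
move/mnm_pigeonhole=> [i /submK <-]; rewrite mpolyXD -mpolyXn.
by case: Jid => _ _; apply.
Qed.

Hypothesis i0 : 'I_n.

Lemma ordge_integral f : (0 < N)%N -> ordge N f -> integral_closure J f.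
Proof.
move=> N_gt0 fN; pose M := (n * N)%N.
(* Bounding degrees by [M.+1] gives a finite type, so the monomials of degree [M] can be
   enumerated. *)
pose D := [set m : 'X_{1..n < M.+1} | mdeg m == M].
pose w (i : 'I_#|D|) : {mpoly K[n]} := 'X_[enum_val i].
have wE m : mdeg m = M -> exists i, w i = 'X_[m].
  move=> mM; have lt_m : (mdeg m < M.+1)%N by rewrite mM.
  have mD : BMultinom lt_m \in D by rewrite inE /= mM.
  by exists (enum_rank_in mD (BMultinom lt_m)); rewrite /w enum_rankK_in.
apply: (determinant_trick (w := w)) => // [|i].
  have [|i wi] := wE (U_(i0) *+ M)%MM; first by rewrite mdegMn mdeg1 mul1n.
  exists i; rewrite wi; apply/eqP => /mpolyP /(_ (U_(i0) *+ M)%MM) /eqP.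
  by rewrite mcoeffX mcoeff0 eqxx oner_eq0.
(* This is the product of [J] with the ideal of monomials of degree [M]. Being an ideal, it can be
   tested on monomials of degree at least [N + M]. *)
pose span g := exists2 a : 'I_#|D| -> {mpoly K[n]},
  forall j, J (a j) & g = \sum_j a j * w j.
have span_ideal : is_ideal span.
  have [J0 JD JM] := Jid; split.
  - by exists (fun=> 0) => //; rewrite big1 // => j _; rewrite mul0r.
  - move=> g h [a Ja ->] [b Jb ->]; exists (fun j => a j + b j) => [j|].
      exact: JD.
    by rewrite -big_split; apply: eq_bigr => j _; rewrite mulrDl.
  - move=> g h [a Ja ->]; exists (fun j => g * a j) => [j|]; first exact: JM.
    by rewrite mulr_sumr; apply: eq_bigr => j _; rewrite mulrA.
suff : span (f * w i) by [].
apply: (@ordge_sub _ (N + M)) => // [m le_m|]; last first.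
  apply: ordgeM => //; apply: ordgeX.
  by have := enum_valP i; rewrite inE => /eqP ->.
(* As [N > 0], the degree of [m] exceeds [n * N], so some ['X_j ^+ N] divides [m]. The quotient has
   degree at least [M]; a divisor of degree [M] is split off, and the cofactor [u] joins the
   coefficient. *)
have [|j /submK mE] := @mnm_pigeonhole m N; first by rewrite -/M; lia.
have := congr1 mdeg mE; rewrite mdegD mdegMn mdeg1 mul1n => mdegE.
have [|m' /submK m'E /wE[k wk]] := @mnm_divisor (m - U_(j) *+ N)%MM M; first lia.
rewrite -mE -m'E !mpolyXD -wk -mpolyXn; set u := 'X_[_ - _].
exists (fun l => if l == k then u * 'X_j ^+ N else 0) => [l|].
  by case: eqP => _; case: Jid => // _ _; apply.
rewrite (bigD1 k) //= eqxx big1 ?addr0 => [|l /negPf->]; last by rewrite mul0r.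
by rewrite mulrAC.
Qed.

(** * Lower bound for the v-number *)

Lemma colon_prime_var f P i :
  is_prime P -> same_set (colon J f) P -> J ('X_i * f).
Proof.
case=> Pid P1 PM JP; apply/JP.
(* The prime [P] contains [J], hence a power of the variable, hence the variable. *)
have : P ('X_i ^+ N) by apply/JP; rewrite /colon; apply: ideal_mulr.
elim: N => [/P1//|k IHk]; rewrite exprS => /PM[] //.
Qed.

Lemma vnumber_lower_bound e f P : (forall g, J g -> ordge N g) ->
  f \is e.-homog -> is_prime P -> same_set (colon J f) P -> (N - 1 <= e)%N.
Proof.
move=> JN fe Pp JP; have Jf := colon_prime_var i0 Pp JP.
have f0 : f != 0.
  case: Pp => _ P1 _; apply/eqP => f0; apply: P1; apply/JP.
  by rewrite /colon f0 mulr0; case: Jid.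
rewrite leqNgt; apply/negP => lt_e.
(* A form of degree [1 + e < N] in [ordge N] is zero. *)
have /eqP : 'X_i0 * f = 0.
  apply: (@ordge_dhomog_eq0 _ (1 + e) N); [|exact: JN|lia].
  by apply: dhomogM fe; rewrite dhomogX /= mdeg1.
rewrite mulf_eq0 (negPf f0) orbF => /eqP /mpolyP /(_ U_(i0)%MM) /eqP.
by rewrite mcoeffXU mcoeff0 eqxx oner_eq0.
Qed.

End PrimaryIdeal.

(** * Socle elements and existence of the v-number *)

Lemma ordge1P f : ordge 1 f <-> f@_0 = 0.
Proof.
split=> [f1|f0 m]; first by apply: f1; rewrite mdeg0.
by rewrite ltnS leqn0 mdeg_eq0 => /eqP ->.
Qed.

Lemma ordge1_prime : is_prime (ordge 1).
Proof.
split=> [||f g]; first exact: ordge_ideal.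
  by move/ordge1P/eqP; rewrite mcoeff1 eqxx oner_eq0.
move/ordge1P; rewrite rmorphM => /eqP; rewrite mulf_eq0.
by case/orP=> /eqP /ordge1P; [left|right].
Qed.

(** Such an [f] is a socle element modulo [J]: an element of the colon ideal with nonzero constant
    term would put a unit there, and so [f] in [J]. *)
Lemma colon_ordge1 J f : is_ideal J -> ~ J f -> (forall i, J ('X_i * f)) ->
  same_set (colon J f) (ordge 1).
Proof.
move=> Jid Jf JX.
have sub g : ordge 1 g -> colon J f g.
  have [J0 JD JM] := Jid.
  apply: ordge_sub => [|m m_gt0].
    split=> [|h1 h2 J1 J2|h1 h2 J2]; rewrite /colon ?mul0r //.
      by rewrite mulrDl; apply: JD.
    by rewrite -mulrA; apply: JM.
  have [m' /submK <- /eqP/mdeg1P[i /eqP ->]] := mnm_divisor m_gt0.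
  by rewrite /colon mpolyXD -mulrA; apply: JM.
move=> g; split=> [Jg|]; last exact: sub.
apply/ordge1P/eqP/negP => /negP g0; apply: Jf.
have [J0 JD JM] := Jid.
have : J ((g@_0)%:MP * f).
  rewrite (_ : _ * f = g * f + - ((g - (g@_0)%:MP) * f)); last by ring.
  apply: JD => //; apply: ideal_opp => //; apply: sub; apply/ordge1P.
  by rewrite mcoeffB mcoeffC eqxx mulr1 subrr.
move/(JM ((g@_0)^-1)%:MP); rewrite mulrA -mpolyCM mulVf // mpolyC1.
by rewrite mul1r.
Qed.

Lemma ordge1_vnumber J e f : is_ideal J -> ~ J f -> (forall i, J ('X_i * f)) ->
  f \is e.-homog -> exists f P,
    [/\ f \is e.-homog, is_associated_prime J P & same_set (colon J f) P].
Proof.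
move=> Jid Jf JX fe; have JP := colon_ordge1 Jid Jf JX.
exists f, (ordge 1); split=> //; split; first exact: ordge1_prime.
by exists f.
Qed.

(** Starting from 1, a form outside [J] is multiplied by variables while the product stays outside
    [J]. Its degree stays below [B], so the climb ends at a socle form; [k] bounds the steps
    left. *)
Lemma vnumber_exists J B : is_ideal J -> ~ J 1 ->
  (forall f, ordge B f -> J f) -> exists v, is_vnumber J v.
Proof.
move=> Jid J1 JB; apply: is_min_exists.
suff socle k e f : (B <= e + k)%N -> f \is e.-homog -> ~ J f ->
    exists e' f', [/\ f' \is e'.-homog, ~ J f' & forall i, J ('X_i * f')].
  have [|e [f [fe Jf JX]]] := @socle B 0 1 _ (@dhomog1 _ _ _) J1; first by [].
  by exists e; apply: (ordge1_vnumber Jid Jf JX fe).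
elim: k e f => [|k IHk] e f le_B fe Jf.
  case: Jf; apply: JB; apply: ordge_le (dhomog_ordge fe).
  by rewrite addn0 in le_B.
case: (classic (forall i, J ('X_i * f))) => [JX|/not_all_ex_not[i Ji]].
  by exists e, f.
apply: (IHk (1 + e)%N _ _ _ Ji); first by lia.
by apply: dhomogM fe; rewrite dhomogX /= mdeg1.
Qed.

Lemma vnumber_ordge J N (i0 : 'I_n) : (0 < N)%N -> same_set J (ordge N) ->
  is_vnumber J (N - 1).
Proof.
move=> N_gt0 JN; have [O0 OD OM] := ordge_ideal N.
have Jid : is_ideal J.
  split=> [|f g /JN Jf /JN Jg|f g /JN Jg]; apply/JN => //.
    exact: OD.
  exact: OM.
split=> [|e [f [P [fe [Pp _] JP]]]].
  (* A power of one variable just outside [ordge N] is a socle element; [N_gt0] keeps the truncated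
     subtraction exact. *)
  apply: (@ordge1_vnumber _ _ ('X_[U_(i0) *+ (N - 1)])) => //.
  - move/JN/(_ (U_(i0) *+ (N - 1))%MM); rewrite mdegMn mdeg1 mul1n.
    move=> X0; have /eqP := X0 ltac:(lia).
    by rewrite mcoeffX eqxx oner_eq0.
  - move=> i; apply/JN; rewrite -mpolyXD; apply: ordgeX.
    by rewrite mdegD mdegMn !mdeg1; lia.
  - by rewrite dhomogX /= mdegMn mdeg1 mul1n.
apply: (vnumber_lower_bound Jid _ i0 _ fe Pp JP); last by move=> g /JN.
by move=> i; apply/JN; rewrite mpolyXn; apply: ordgeX; rewrite mdegMn mdeg1 mul1n.
Qed.

(** Stated for any squeezed ideal, so that [I] with [N = d] and [ideal_pow I k] with [N = k * d] are
    both instances. *)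
Lemma vnumber_closure J N (i0 : 'I_n) : (0 < N)%N -> is_ideal J ->
  (forall i : 'I_n, J ('X_i ^+ N)) -> (forall g, J g -> ordge N g) ->
  is_vnumber (integral_closure J) (N - 1)
  /\ exists v, is_vnumber J v /\ (N - 1 <= v)%N.
Proof.
move=> N_gt0 Jid JX JN; split.
  apply: vnumber_ordge => // f; split; first exact: ordge_integral_closure.
  exact: ordge_integral.
(* By the pigeonhole principle [J] contains every monomial of degree above [n * N]. *)
have [||v Jv] := @vnumber_exists J (n * N).+1 Jid.
- move/JN/(_ 0%MM); rewrite mdeg0 mcoeff1 eqxx => /(_ N_gt0) /eqP.
  by rewrite oner_eq0.
- by move=> f; apply: ordge_sub => // m; apply: primary_mnm.
exists v; split=> //; case: Jv => [[f [P [fe [Pp _] JP]]] _].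
exact: (vnumber_lower_bound Jid JX i0 JN fe Pp JP).
Qed.

(** * Generators of an equigenerated primary monomial ideal *)

Lemma monomial_gen_coef S f m : monomial_gen S f -> f@_m != 0 ->
  exists2 m', S m' & (m' <= m)%MM.
Proof.
case=> r Sr ->; rewrite raddf_sum big_seq => /= fm.
(* Some term contributes to the coefficient, and all its monomials are multiples of its
   generator. *)
have [c cr cm] : exists2 c, c \in r & (c.1 * c.2)@_m != 0.
  apply: NNPP => no_c; move/eqP: fm; apply; apply: big1 => c cr.
  by apply/eqP/negP => /negP cm; apply: no_c; exists c.
have [m' Sm' cE] := Sr _ cr; exists m' => //; move: cm.
rewrite cE -mcoeff_msupp (perm_mem (msuppMX _ _)) => /mapP[m'' _ ->].
exact: lem_addr.
Qed.

Lemma irrelevant_ordge1 f : irrelevant_ideal n K f -> ordge 1 f.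
Proof.
apply: ideal_gen_sub; first exact: ordge_ideal.
by move=> _ [i ->]; apply: ordgeX; rewrite mdeg1.
Qed.

End IrrelevantPowers.

(** A generator dividing a monomial of [f0] has degree at most [d], and minimality of [d] gives
    equality, so all generators have degree [d]. One that divides a power of ['X_i] is then
    ['X_i ^+ d]. *)
Lemma equigenerated_primary (K : fieldType) n (I : {mpoly K[n]} -> Prop) d :
  equigenerated I -> primary_to (irrelevant_ideal n K) I ->
  is_initial_degree I d ->
  [/\ inhabited 'I_n, (0 < d)%N, forall i : 'I_n, I ('X_i ^+ d)
    & forall f, I f -> ordge d f].
Proof.
move=> [S [[IS _] S_eq]] [[Iid _ _] rad] [[f0 [f0_neq0 If0 f0d]] d_min].
(* [I] lies in its radical, so [f0] has no constant term; this forces [0 < d]. *)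
have f0_1 : ordge 1 f0.
  by apply/irrelevant_ordge1/rad; exists 1%N.
have d_gt0 : (0 < d)%N.
  by rewrite lt0n; apply/eqP => d0; apply/f0_neq0/(ordge_dhomog_eq0 f0d f0_1); lia.
have S_ge m : S m -> (d <= mdeg m)%N.
  move=> Sm; apply: d_min; exists 'X_[m]; split.
  - by move/mpolyP/(_ m)/eqP; rewrite mcoeffX mcoeff0 eqxx oner_eq0.
  - by apply/IS; apply: ideal_gen_id; exists m.
  - by rewrite dhomogX.
have /mlead_supp m0P : f0 != 0 by apply/eqP.
move: (mlead f0) m0P => m0 m0P.
have m0d : mdeg m0 = d by apply: (dhomog_mf f0d).
have [m1 Sm1 m1m0] : exists2 m', S m' & (m' <= m0)%MM.
  by apply: monomial_gen_coef (_ : f0@_m0 != 0); [apply/IS|rewrite -mcoeff_msupp].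
have S_deg m : S m -> mdeg m = d.
  move=> Sm; rewrite (S_eq _ _ Sm Sm1); apply/eqP; rewrite eqn_leq S_ge // andbT.
  by have := congr1 mdeg (submK m1m0); rewrite mdegD m0d; lia.
split=> //.
(* Without variables every monomial would have degree 0, against [0 < d]. *)
- case: (posnP n) => [n0|n_gt0]; last by constructor; apply: Ordinal n_gt0.
  move: m0d; rewrite mdegE big1 ?d0 => [d0|[i lt_i] _]; last by exfalso; lia.
  by rewrite -d0 in d_gt0.
- move=> i; have [k Ik] : radical I 'X_i.
    by apply/rad; apply: ideal_gen_id; exists i.
  have [m Sm le_m] : exists2 m', S m' & (m' <= U_(i) *+ k)%MM.
    apply: monomial_gen_coef (_ : ('X_i ^+ k)@_(U_(i) *+ k) != 0); first exact/IS.
    by rewrite mcoeffXn eqxx oner_eq0.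
  rewrite mpolyXn -(_ : m = U_(i) *+ d)%MM.
    by apply/IS; apply: ideal_gen_id; exists m.
  have m_off j : j != i -> m j = 0%N.
    move/mnm_lepP: le_m => /(_ j); rewrite mulmnE mnm1E eq_sym => + /negPf ij.
    by rewrite ij leqn0 => /eqP.
  apply/mnmP => j; rewrite mulmnE mnm1E; have [<-|ne_ij] := eqVneq i j.
    rewrite mul1n -(S_deg _ Sm) mdegE (bigD1 i) //= big1 ?addn0 //.
  by rewrite mul0n m_off // eq_sym.
- move=> f /IS; apply: ideal_gen_sub; first exact: ordge_ideal.
  by move=> _ [m Sm ->]; apply: ordgeX; apply: S_ge.
Qed.

Theorem theorem3p4 (K : fieldType) (n : nat) (I : {mpoly K[n]} -> Prop) (d : nat)
  (I_monomial : is_monomial_ideal I)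
  (I_equigenerated : equigenerated I)
  (I_primary : primary_to (irrelevant_ideal n K) I)
  (I_alpha : is_initial_degree I d) :
  (is_vnumber (integral_closure I) (d - 1)
   /\ exists v : nat, is_vnumber I v /\ (d - 1 <= v)%N)
  /\ forall k : nat, (1 <= k)%N ->
     is_vnumber (integral_closure (ideal_pow I k)) (k * d - 1)
     /\ exists v : nat, is_vnumber (ideal_pow I k) v /\ (k * d - 1 <= v)%N.
Proof.
have [[i0] d_gt0 IX Id] := equigenerated_primary I_equigenerated I_primary I_alpha.
have Iid : is_ideal I by case: I_primary => [[]].
split=> [|k k_gt0]; first exact: vnumber_closure.
apply: vnumber_closure => //.
- by rewrite muln_gt0 k_gt0.
- exact: ideal_pow_ideal.
- by move=> i; rewrite mulnC exprM; apply: ideal_pow_exp.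
- by move=> g; apply: ordge_pow.
Qed.
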